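(* Let $\rho\in[0,\infty]$ and let $k$ be a $\rho$-$\delta$viable kernel structure on $\mathbb{R}^{2m+1}$ (i.e. $\Delta_k^\rho\neq\varnothing$). Let $J:(0,\infty)\times\Phi_k\to\mathbb{R}$, $\iota\in(0,\infty)$, $\chi\in(0,1)$, and let $(\beta,\eta)$ be an optimal solution of $$\min_{\beta\in[\iota,\infty),\ \eta\in\Delta_k^\rho} J(\beta,\eta).$$ Let $f$ be the optimal solution of $$\min_{f\in\mathcal{H}(k_\eta)}\ \sum_{i=m+1}^n\big(f(\bar z_i)-\bar y_i\big)^2+\beta|f|_{k_\eta}^2\quad\text{subject to}\quad m|f|_{k_\eta}^2\le\chi .$$ Then $\Sigma(f)$ is $\delta$BIBS stable. If, in addition, $f$ is uniformly continuous, then $\Sigma(f)$ has the w$\delta$AG property with incremental asymptotic bias $b(\rho)$, where $b(\cdot)$ is a class-$\mathcal{K}$ function (for $\rho=\infty$ this is read as: with some finite incremental asymptotic bias). Finally, if $\rho=0$, then $\Sigma(f)$ is $\delta$ISS.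
   Context: $|\cdot|$ is the Euclidean norm; $|x|_\infty=\sup_t|x_t|\in[0,\infty]$ for a sequence $x$ (finite or infinite); $x_{0:t}=(x_0,\dots,x_t)$; $\mathbb{N}$ contains $0$. A function $\gamma:[0,\infty)\to[0,\infty)$ is of class $\mathcal{K}$ if it is continuous, strictly increasing and $\gamma(0)=0$. A function $\alpha:[0,\infty)^2\to[0,\infty)$ is of class $\mathcal{KL}$ if $\alpha(\cdot,t)$ is of class $\mathcal{K}$ for each $t$, and for each $s$, $\alpha(s,\cdot)$ is continuous, decreasing and tends to $0$ at infinity. System. Let $m\in\mathbb{N}$, $m\ge1$. For $f:\mathbb{R}^{2m+1}\to\mathbb{R}$ (written $f(x,v)$ with $x\in\mathbb{R}^{2m}$, $v\in\mathbb{R}$), $\Sigma(f)$ is the discrete-time system $$x_{t+1}=Ax_t+Gf(x_t,v_t)+G\varepsilon_t+Hv_t,\quad t\in\mathbb{N},$$ with state $x_t\in\mathbb{R}^{2m}$ and inputs $v_t,\varepsilon_t\in\mathbb{R}$, where $A=\mathrm{diag}(S,S)$ (block diagonal), $G=\mathrm{col}(B,0_m)$, $H=\mathrm{col}(0_m,B)$ (vertical stacking), $S=\begin{bmatrix}0_{m-1}&I_{m-1}\\0&0_{m-1}^\top\end{bmatrix}\in\mathbb{R}^{m\times m}$, $B=\begin{bmatrix}0_{m-1}\\1\end{bmatrix}\in\mathbb{R}^m$. A solution is a triple of sequences $(x,v,\varepsilon)$ satisfying this recursion. Incremental stability notions. For two solutions $(x^a,v^a,\varepsilon^a)$, $(x^b,v^b,\varepsilon^b)$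 of $\Sigma(f)$ let $\tilde x=x^a-x^b$, $\tilde v=v^a-v^b$, $\tilde\varepsilon=\varepsilon^a-\varepsilon^b$. - $\Sigma(f)$ is $\delta$BIBS stable if for every $q\in[0,\infty)$ there is $w\in[0,\infty)$ such that every two solutions with $|\tilde x_0|\le q$, $|\tilde v|_\infty\le q$, $|\tilde\varepsilon|_\infty\le q$ satisfy $|\tilde x|_\infty\le w$. - $\Sigma(f)$ is $\delta$ISS if there exist $\alpha$ of class $\mathcal{KL}$ and $\kappa_u,\kappa_e$ of class $\mathcal{K}$ such that every two solutions satisfy $|\tilde x_t|\le\alpha(|\tilde x_0|,t)+\kappa_u(|\tilde v_{0:t}|_\infty)+\kappa_e(|\tilde\varepsilon_{0:t}|_\infty)$ for all $t\in\mathbb{N}$. - $\Sigma(f)$ has the w$\delta$AG (weak incremental asymptotic gain) property with incremental asymptotic bias $b\in[0,\infty)$ if there is a class-$\mathcal{K}$ function $\kappa$ such that every two solutions satisfy $\limsup_{t\to\infty}|\tilde x_t|\le b+\kappa(\limsup_{t\to\infty}\max(|\tilde v_t|,|\tilde\varepsilon_t|))$ (the inequality being required when the limsup on the right is finite). Kernels. A kernel structure $k$ consists of a parameter set $\Phi_k\subseteq\mathbb{R}^{n_\eta}$ and, for each $\eta\in\Phi_k$, a symmetric positive semidefinite kernel $k_\eta:\mathbb{R}^{2m+1}\times\mathbb{R}^{2m+1}\to\mathbb{R}$. $\mathcal{H}(k_\eta)$ is the reproducing kernel Hilbert space (RKHS) of $k_\eta$, with norm $|\cdot|_{k_\eta}$.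 Let $h_\eta(a,b)=k_\eta(a,a)-2k_\eta(a,b)+k_\eta(b,b)$. For $\rho\in[0,\infty]$, the $\rho$-$\delta$viability set $\Delta_k^\rho$ is the set of $\eta\in\Phi_k$ for which there exist $\nu\in[0,\rho]\cap\mathbb{R}$ and $s\in[0,\infty)$ such that for all $a,b\in\mathbb{R}^{2m+1}$: $|a-b|^2\ge\nu\Rightarrow h_\eta(a,b)\le|a-b|^2$, and $|a-b|^2<\nu\Rightarrow h_\eta(a,b)\le s$. $k$ is $\rho$-$\delta$viable if $\Delta_k^\rho\ne\varnothing$. Data. $n\in\mathbb{N}$, $n>m$, and a dataset of real numbers $(\bar u_i,\bar y_i)_{i=1}^n$ is given; for $t\in\{m+1,\dots,n\}$, $\bar z_t=(\bar y_{t-m},\dots,\bar y_{t-1},\bar u_{t-m},\dots,\bar u_t)\in\mathbb{R}^{2m+1}$. The function $J$ may depend on the dataset. *)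

(* Defs.v *)
From HB Require Import structures.
From mathcomp Require Import all_boot all_order all_algebra.
From mathcomp Require Import all_classical all_reals all_analysis.

Set Implicit Arguments.
Unset Strict Implicit.
Unset Printing Implicit Defensive.

Import Order.TTheory GRing.Theory Num.Theory numFieldNormedType.Exports.

Local Open Scope classical_set_scope.
Local Open Scope ring_scope.

(* Euclidean norm; the library norm on matrices is the maximum norm. *)
Definition enorm (R : realType) (d : nat) (x : 'cV[R]_d) : R :=
  Num.sqrt (\sum_(i < d) x i 0 ^+ 2).

(* Below, [u t] is the norm of the [t]-th term of the sequence at hand. *)
Definition supnorm (R : realType) (u : nat -> R) : \bar R :=
  ereal_sup (range (fun t => (u t)%:E)).

(* Norm of the finite sequence with terms of norm u 0, ..., u t (u >= 0). *)
Definition supnorm_upto (R : realType) (u : nat -> R) (t : nat) : R :=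
  \big[Num.max/0]_(i < t.+1) u i.

(* Comparison functions live on [0, +oo[; their values elsewhere on R are
   irrelevant. Nonnegativity follows from monotonicity and g 0 = 0. *)
Definition class_K (R : realType) (g : R -> R) : Prop :=
  [/\ {within `[0, +oo[%classic, continuous g},
      {in `[0, +oo[ &, {homo g : r s / r < s}} &
      g 0 = 0].

(* "Decreasing" is meant in the weak sense: alpha 0 is identically 0. *)
Definition class_KL (R : realType) (alpha : R -> R -> R) : Prop :=
  (forall t : R, 0 <= t -> class_K (alpha ^~ t)) /\
  (forall s : R, 0 <= s ->
    [/\ {within `[0, +oo[%classic, continuous (alpha s)},
        {in `[0, +oo[ &, {homo alpha s : r t / r <= t >-> t <= r}} &
        alpha s t @[t --> +oo] --> (0 : R)]).

Section System.
Variables (R : realType) (m : nat).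

Definition shift_mx : 'M[R]_m := \matrix_(i, j) (j == i.+1 :> nat)%:R.
Definition last_cv : 'cV[R]_m := \col_i (i.+1 == m)%:R.

Definition sysA : 'M[R]_(m + m) := block_mx shift_mx 0 0 shift_mx.
Definition sysG : 'cV[R]_(m + m) := col_mx last_cv 0.
Definition sysH : 'cV[R]_(m + m) := col_mx 0 last_cv.

Definition pair_cv (x : 'cV[R]_(m + m)) (v : R) : 'cV[R]_(m + m + 1) :=
  col_mx x v%:M.

Variable f : 'cV[R]_(m + m + 1) -> R.

Definition solution (x : nat -> 'cV[R]_(m + m)) (v e : nat -> R) : Prop :=
  forall t, x t.+1 =
    sysA *m x t + f (pair_cv (x t) (v t)) *: sysG + e t *: sysG + v t *: sysH.

Definition dBIBS : Prop :=
  forall q : R, 0 <= q -> exists2 w : R, 0 <= w &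
    forall xa va ea xb vb eb, solution xa va ea -> solution xb vb eb ->
      enorm (xa 0%N - xb 0%N) <= q ->
      (supnorm (fun t => `|va t - vb t|)%R <= q%:E)%E ->
      (supnorm (fun t => `|ea t - eb t|)%R <= q%:E)%E ->
      (supnorm (fun t => enorm (xa t - xb t))%R <= w%:E)%E.

Definition dISS : Prop :=
  exists alpha kappa_u kappa_e,
    [/\ class_KL alpha, class_K kappa_u, class_K kappa_e &
    forall xa va ea xb vb eb, solution xa va ea -> solution xb vb eb ->
    forall t : nat, enorm (xa t - xb t) <=
      alpha (enorm (xa 0%N - xb 0%N)) t%:R
      + kappa_u (supnorm_upto (fun i => `|va i - vb i|) t)
      + kappa_e (supnorm_upto (fun i => `|ea i - eb i|) t)].

Definition wdAG (b : R) : Prop :=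
  0 <= b /\ exists2 kappa, class_K kappa &
    forall xa va ea xb vb eb, solution xa va ea -> solution xb vb eb ->
      let L := limn_esup
        (fun t => (Num.max `|va t - vb t| `|ea t - eb t|)%:E) in
      (L < +oo)%E ->
      (limn_esup (fun t => (enorm (xa t - xb t)%R)%:E)
        <= (b + kappa (fine L))%R%:E)%E.

(* (y_{t-m}, ..., y_{t-1}, u_{t-m}, ..., u_t) *)
Definition regressor (u y : nat -> R) (t : nat) : 'cV[R]_(m + m + 1) :=
  pair_cv (col_mx (\col_(j < m) y (t - m + j)%N) (\col_(j < m) u (t - m + j)%N))
          (u t).

End System.

Definition psd_kernel (R : realType) (X : Type) (k : X -> X -> R) : Prop :=
  (forall a b, k a b = k b a) /\
  (forall (N : nat) (a : 'I_N -> X) (c : 'I_N -> R),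
     0 <= \sum_(i < N) \sum_(j < N) c i * c j * k (a i) (a j)).

(* A reproducing kernel Hilbert space of k: a Hilbert space of functions on X
   (its members form rk_mem; rk_ip is only meaningful on rk_mem) containing the
   sections of k and having the reproducing property. For k symmetric positive
   semidefinite it exists and is unique (Moore-Aronszajn). *)
Record rkhs (R : realType) (X : Type) (k : X -> X -> R) := Rkhs {
  rk_mem : set (X -> R) ;
  rk_ip : (X -> R) -> (X -> R) -> R ;
  rk_mem0 : rk_mem (fun=> 0) ;
  rk_mem_lin : forall (c : R) f g, rk_mem f -> rk_mem g ->
    rk_mem (fun x => c * f x + g x) ;
  rk_ipC : forall f g, rk_mem f -> rk_mem g -> rk_ip f g = rk_ip g f ;
  rk_ip_lin : forall (c : R) f g h, rk_mem f -> rk_mem g -> rk_mem h ->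
    rk_ip (fun x => c * f x + g x) h = c * rk_ip f h + rk_ip g h ;
  rk_ip_ge0 : forall f, rk_mem f -> 0 <= rk_ip f f ;
  rk_ip_eq0 : forall f, rk_mem f -> rk_ip f f = 0 -> f = (fun=> 0) ;
  rk_norm := fun f => Num.sqrt (rk_ip f f) ;
  rk_complete : forall u : nat -> X -> R, (forall i, rk_mem (u i)) ->
    (forall e : R, 0 < e -> exists N : nat, forall i j, (N <= i)%N -> (N <= j)%N ->
      rk_norm (fun x => u i x - u j x) < e) ->
    exists2 f, rk_mem f &
      rk_norm (fun x => u i x - f x) @[i --> \oo] --> (0 : R) ;
  rk_section : forall a, rk_mem (k a) ;
  rk_reproducing : forall f a, rk_mem f -> rk_ip f (k a) = f a
}.

Record kernel_structure (R : realType) (d neta : nat) := KernelStructure {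
  ks_param : set 'cV[R]_neta ;
  ks_kernel :> 'cV[R]_neta -> 'cV[R]_d -> 'cV[R]_d -> R ;
  ks_psd : forall eta, ks_param eta -> psd_kernel (ks_kernel eta)
}.

Section Viability.
Variables (R : realType) (d neta : nat) (k : kernel_structure R d neta).

Definition kdist2 (eta : 'cV[R]_neta) (a b : 'cV[R]_d) : R :=
  k eta a a - 2 * k eta a b + k eta b b.

Definition viability_set (rho : \bar R) : set 'cV[R]_neta :=
  [set eta | ks_param k eta /\
    exists nu s : R, [/\ 0 <= nu, (nu%:E <= rho)%E, 0 <= s &
      forall a b : 'cV[R]_d,
        (nu <= enorm (a - b) ^+ 2 -> kdist2 eta a b <= enorm (a - b) ^+ 2) /\
        (enorm (a - b) ^+ 2 < nu -> kdist2 eta a b <= s)]].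

Definition delta_viable (rho : \bar R) : Prop := viability_set rho !=set0.

End Viability.

Definition minimizer (R : realType) (T : Type) (C : set T) (F : T -> R) (p : T)
  : Prop := C p /\ forall q, C q -> F p <= F q.

(* The data (u_i, y_i) are read at the indices 1 <= i <= n only. *)
Definition fit_cost (R : realType) (m n : nat) (u y : nat -> R) (beta : R)
    (k : 'cV[R]_(m + m + 1) -> 'cV[R]_(m + m + 1) -> R) (H : rkhs k)
    (f : 'cV[R]_(m + m + 1) -> R) : R :=
  \sum_(m.+1 <= i < n.+1) (f (regressor m u y i) - y i) ^+ 2
  + beta * rk_norm H f ^+ 2.

(* Main.v *)
Require Import Defs.
From HB Require Import structures.
From mathcomp Require Import all_boot all_order all_algebra.
From mathcomp Require Import all_classical all_reals all_analysis.
From mathcomp Require Import ring lra.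

Set Implicit Arguments.
Unset Strict Implicit.
Unset Printing Implicit Defensive.

Import Order.TTheory GRing.Theory Num.Theory numFieldNormedType.Exports.
Local Open Scope classical_set_scope.
Local Open Scope ring_scope.

(** Pushing [b] away from [a] along their line shows that the viability bound,
    assumed only at distance at least [sqrt nu], gives by Cauchy-Schwarz
    [|f a - f b| <= |f|_k (|a - b| + 2 sqrt nu)] for all [a, b], whatever the
    bound at short distance. Since [m |f|_k^2 <= chi < 1], the incremental
    dynamics is then a contraction up to inputs and an additive defect
    proportional to [sqrt nu], in a weighted maximum norm: the incremental state
    satisfies an exponential ISS estimate with additive bias [C sqrt nu], where
    [C] depends on [m] and [chi] only. All three properties follow from it, with
    [b r = C sqrt r]. *)

(** * Euclidean norm of columns and of stacked columns *)

Lemma enorm_ge0 (R : realType) (d : nat) (x : 'cV[R]_d) : 0 <= enorm x.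
Proof. exact: sqrtr_ge0. Qed.

Lemma sqr_enorm (R : realType) (d : nat) (x : 'cV[R]_d) :
  enorm x ^+ 2 = \sum_(i < d) x i 0 ^+ 2.
Proof. by rewrite sqr_sqrtr// sumr_ge0// => i _; rewrite sqr_ge0. Qed.

Lemma enormZ (R : realType) (d : nat) (c : R) (x : 'cV[R]_d) :
  enorm (c *: x) = `|c| * enorm x.
Proof.
rewrite /enorm -sqrtr_sqr -sqrtrM ?sqr_ge0// mulr_sumr.
by congr Num.sqrt; apply: eq_bigr => i _; rewrite mxE exprMn.
Qed.

Lemma enorm_eq0 (R : realType) (d : nat) (x : 'cV[R]_d) : enorm x = 0 -> x = 0.
Proof.
move=> x0; have /eqP := sqr_enorm x.
rewrite x0 expr0n/= eq_sym psumr_eq0; last by move=> i _; rewrite sqr_ge0.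
move=> /allP xi0; apply/colP => i; rewrite mxE.
by have := xi0 i (mem_index_enum i); rewrite sqrf_eq0 => /eqP.
Qed.

Lemma norm_entry_le_enorm (R : realType) (d : nat) (x : 'cV[R]_d) (i : 'I_d) :
  `|x i 0| <= enorm x.
Proof.
rewrite -sqrtr_sqr ler_wsqrtr// (bigD1 i)//= lerDl sumr_ge0// => j _.
exact: sqr_ge0.
Qed.

Lemma enorm_le_sup (R : realType) (d : nat) (x : 'cV[R]_d) (M : R) :
  0 <= M -> (forall i, `|x i 0| <= M) -> enorm x <= Num.sqrt d%:R * M.
Proof.
move=> M0 xM; rewrite -(ger0_norm M0) -sqrtr_sqr -sqrtrM// ler_wsqrtr//.
rewrite mulr_natl -[in leRHS](card_ord d) -sumr_const; apply: ler_sum => i _.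
by rewrite -real_normK ?num_real// lerXn2r ?nnegrE.
Qed.

Lemma enorm_col_mx_le (R : realType) (d e : nat) (x : 'cV[R]_d) (y : 'cV[R]_e) :
  enorm (col_mx x y) <= enorm x + enorm y.
Proof.
rewrite -(@ler_pXn2r _ 2) ?nnegrE ?addr_ge0 ?enorm_ge0//
  sqr_enorm big_split_ord/=.
under eq_bigr do rewrite col_mxEu.
under [X in _ + X]eq_bigr do rewrite col_mxEd.
rewrite -!sqr_enorm sqrrD -addrA [_ *+ 2 + _]addrC addrA lerDl mulrn_wge0//.
by rewrite mulr_ge0 ?enorm_ge0.
Qed.

Lemma enorm_usubmx_le (R : realType) (d e : nat) (x : 'cV[R]_(d + e)) :
  enorm (usubmx x) <= enorm x.
Proof.
rewrite ler_wsqrtr// big_split_ord/=; under eq_bigr do rewrite mxE.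
by rewrite lerDl sumr_ge0// => i _; rewrite sqr_ge0.
Qed.

Lemma enorm_dsubmx_le (R : realType) (d e : nat) (x : 'cV[R]_(d + e)) :
  enorm (dsubmx x) <= enorm x.
Proof.
rewrite ler_wsqrtr// big_split_ord/=; under eq_bigr do rewrite mxE.
by rewrite lerDr sumr_ge0// => i _; rewrite sqr_ge0.
Qed.

(** * Increments of functions in a reproducing kernel Hilbert space *)

Lemma rkhs_cauchy_schwarz (R : realType) (X : Type) (k : X -> X -> R)
    (H : rkhs k) (f g : X -> R) : rk_mem H f -> rk_mem H g ->
  `|rk_ip H f g| <= rk_norm H f * Num.sqrt (rk_ip H g g).
Proof.
move=> Hf Hg; rewrite -sqrtrM ?rk_ip_ge0// -sqrtr_sqr ler_wsqrtr//.
have quad c : 0 <= rk_ip H f f * c ^+ 2 + 2 * rk_ip H f g * c + rk_ip H g g.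
  have Hcfg := rk_mem_lin c Hf Hg.
  have := rk_ip_ge0 Hcfg; rewrite rk_ip_lin//.
  rewrite (rk_ipC Hf Hcfg) (rk_ipC Hg Hcfg) !rk_ip_lin// (rk_ipC Hg Hf).
  by move=> /le_trans; apply; rewrite le_eqVlt; apply/orP; left;
    apply/eqP; ring.
have := rk_ip_ge0 Hf; rewrite le_eqVlt => /predU1P[A0|A0].
  rewrite -A0 mul0r; have f0 := rk_ip_eq0 Hf (esym A0).
  have := rk_ip_lin 1 Hf Hf Hg; rewrite f0 /=.
  have -> : (fun=> 1 * 0 + 0) = (fun=> 0) :> (X -> R).
    by apply/funext => x; rewrite mulr0 addr0.
  by rewrite mul1r -{1}[LHS]addr0 => /addrI <-; rewrite expr0n.
(* The vertex of the quadratic, where its value is the Schur complement; the degenerate case of zero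
   leading coefficient forces [f] to be zero and is settled above. *)
have := quad (- (rk_ip H f g / rk_ip H f f)).
set A := rk_ip H f f in A0 *; set B := rk_ip H f g; set D := rk_ip H g g.
have -> : A * (- (B / A)) ^+ 2 + 2 * B * - (B / A) + D = (A * D - B ^+ 2) / A.
  by field; rewrite gt_eqF.
by rewrite pmulr_lge0 ?invr_gt0// subr_ge0.
Qed.

(** By the reproducing property, [f a - f b] is the inner product of [f] with [g], the difference of
    the sections at [a] and [b], and the squared norm of [g] is the kernel distance. Cauchy-Schwarz
    concludes. *)
Lemma rkhs_diff_le (R : realType) (X : Type) (k : X -> X -> R)
    (H : rkhs k) (f : X -> R) (a b : X) : rk_mem H f ->
  `|f a - f b| <= rk_norm H f * Num.sqrt (k a a - 2 * k a b + k b b).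
Proof.
move=> Hf; pose g x := -1 * k b x + k a x.
have Ha := rk_section H a; have Hb := rk_section H b.
have Hg : rk_mem H g by exact: rk_mem_lin.
have ipg h : rk_mem H h -> rk_ip H g h = h a - h b.
  move=> Hh; rewrite rk_ip_lin// (rk_ipC Hb Hh) (rk_ipC Ha Hh).
  by rewrite !rk_reproducing// mulN1r addrC.
have kab : k b a = k a b.
  by rewrite -(rk_reproducing a Hb) -(rk_reproducing b Ha) rk_ipC.
have -> : k a a - 2 * k a b + k b b = rk_ip H g g.
  by rewrite ipg// /g kab; ring.
by rewrite -ipg// rk_ipC//; apply: rkhs_cauchy_schwarz.
Qed.

Lemma viable_rkhs_diff_le (R : realType) (d : nat)
    (k : 'cV[R]_d -> 'cV[R]_d -> R) (H : rkhs k) (f : 'cV[R]_d -> R)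
    (nu : R) : 0 <= nu ->
  (forall a b : 'cV[R]_d, nu <= enorm (a - b) ^+ 2 ->
     k a a - 2 * k a b + k b b <= enorm (a - b) ^+ 2) ->
  rk_mem H f -> forall a b,
  `|f a - f b| <= rk_norm H f * (enorm (a - b) + 2 * Num.sqrt nu).
Proof.
move=> nu0 hk Hf.
have far a b : nu <= enorm (a - b) ^+ 2 ->
    `|f a - f b| <= rk_norm H f * enorm (a - b).
  move=> nab; apply: le_trans (rkhs_diff_le a b Hf) _.
  rewrite ler_wpM2l ?sqrtr_ge0//.
  rewrite -[leRHS](ger0_norm (enorm_ge0 _)) -sqrtr_sqr ler_wsqrtr//.
  exact: hk.
move=> a b; have [/far h|near] := leP nu (enorm (a - b) ^+ 2).
  apply: le_trans h _; rewrite ler_wpM2l ?sqrtr_ge0//.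
  by rewrite lerDl mulr_ge0 ?sqrtr_ge0.
have [->|ab] := eqVneq a b.
  by rewrite !subrr normr0 mulr_ge0 ?addr_ge0 ?mulr_ge0 ?enorm_ge0 ?sqrtr_ge0.
have e0 : 0 < enorm (a - b).
  rewrite lt_neqAle enorm_ge0 andbT eq_sym; apply: contra_neq ab => /enorm_eq0.
  by move/eqP; rewrite subr_eq0 => /eqP.
(* Continue the segment from [a] to [b] past [b] by the length [sqrt nu]:
   its end [c] is far from both points. *)
pose s := Num.sqrt nu / enorm (a - b); pose c := b - s *: (a - b).
have s0 : 0 <= s by rewrite divr_ge0 ?sqrtr_ge0 ?enorm_ge0.
have bc : enorm (b - c) = Num.sqrt nu.
  by rewrite opprB addrC subrK enormZ ger0_norm// mulfVK ?gt_eqF.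
have ac : enorm (a - c) = enorm (a - b) + Num.sqrt nu.
  have -> : a - c = (1 + s) *: (a - b).
    by rewrite scalerDl scale1r /c opprB addrCA addrC.
  by rewrite enormZ ger0_norm ?addr_ge0// mulrDl mul1r mulfVK ?gt_eqF.
have fac : `|f a - f c| <= rk_norm H f * enorm (a - c).
  apply: far; rewrite ac -{1}(sqr_sqrtr nu0) lerXn2r ?nnegrE ?sqrtr_ge0//.
    by rewrite addr_ge0 ?sqrtr_ge0 ?enorm_ge0.
  by rewrite lerDr enorm_ge0.
have fbc : `|f b - f c| <= rk_norm H f * enorm (b - c).
  by apply: far; rewrite bc sqr_sqrtr.
(* Triangle inequality through [c]: the two lengths add up to the distance from [a] to [b] plus
   twice [sqrt nu]. *)
rewrite -[f a](subrK (f c)) -addrA (le_trans (ler_normD _ _))//.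
rewrite (distrC (f c)) (le_trans (lerD fac fbc))// ac bc -mulrDr.
by rewrite -addrA -[X in _ + X]mulr2n mulr_natl.
Qed.

(** * A weighted maximum norm in which the shift contracts *)

Section WeightedMax.
Variables (R : realType) (m : nat) (lam : R).
Hypotheses (lam0 : 0 < lam) (lam1 : lam < 1).
Implicit Type z : 'cV[R]_m.

(** The weights grow with the index, so an entry moved from index [i.+1] to [i] loses a factor
    [lam]. *)
Definition wmax z : R := \big[Num.max/0]_(i < m) (`|z i 0| / lam ^+ i).

Lemma wmax_ge0 z : 0 <= wmax z.
Proof. exact: bigmax_ge_id. Qed.

Lemma norm_entry_le_wmax z i : `|z i 0| <= lam ^+ i * wmax z.
Proof.
rewrite mulrC -ler_pdivrMr ?exprn_gt0//.
exact: (le_bigmax 0 (fun i : 'I_m => `|z i 0| / lam ^+ i)).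
Qed.

Lemma enorm_le_wmax z : enorm z <= Num.sqrt m%:R * wmax z.
Proof.
apply: enorm_le_sup => [|i]; first exact: wmax_ge0.
apply: le_trans (norm_entry_le_wmax z i) _.
by rewrite ler_piMl ?wmax_ge0// exprn_ile1// ltW.
Qed.

Lemma wmax_le_enorm z : wmax z <= lam ^- m * enorm z.
Proof.
apply: bigmax_le => [|i _].
  by rewrite mulr_ge0 ?enorm_ge0// invr_ge0 exprn_ge0// ltW.
rewrite mulrC ler_pM ?invr_ge0 ?exprn_ge0 ?(ltW lam0) ?norm_entry_le_enorm//.
rewrite lef_pV2 ?posrE ?exprn_gt0//.
by apply: ler_wiXn2l; [exact: ltW|exact: ltW|exact: ltnW].
Qed.

(** The shift reads the next entry and the last slot receives [a]. The default 0 of [insub] is never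
    reached: off the last slot, [i.+1] is a valid index. *)
Lemma shift_last_entry z (a : R) (i : 'I_m) :
  (shift_mx R m *m z + a *: last_cv R m) i 0 =
  if i.+1 == m then a else
    if insub i.+1 is Some j then z j 0 else 0.
Proof.
rewrite !mxE; under eq_bigr do rewrite mxE.
case: eqVneq => [im|im]; last rewrite mulr0 addr0.
  rewrite mulr1 big1 ?add0r// => j _.
  by rewrite im ltn_eqF ?mul0r// ltn_ord.
have im' : (i.+1 < m)%N by rewrite ltn_neqAle im ltn_ord.
rewrite insubT (bigD1 (Ordinal im'))//= eqxx mul1r big1 ?addr0// => j ji.
rewrite (_ : (_ == _) = false) ?mul0r//.
by apply: contraNF ji => /eqP h; apply/eqP/val_inj.
Qed.

(** Shifted entries gain the factor [lam]; the new entry sits at index [m.-1] and is multiplied by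
    the weight found there. *)
Lemma wmax_shift z (a : R) :
  wmax (shift_mx R m *m z + a *: last_cv R m) <=
  Num.max (lam * wmax z) (`|a| / lam ^+ m.-1).
Proof.
apply: bigmax_le => [|i _].
  by rewrite le_max mulr_ge0 ?wmax_ge0// ltW.
rewrite shift_last_entry le_max; case: eqVneq => [im|im].
  by have /= -> := congr1 predn (esym im); rewrite lexx orbT.
have im' : (i.+1 < m)%N by rewrite ltn_neqAle im ltn_ord.
rewrite insubT; apply/orP; left.
rewrite ler_pdivrMr ?exprn_gt0// mulrAC -exprS.
exact: (norm_entry_le_wmax z (Ordinal im')).
Qed.

End WeightedMax.

(** * The exponential estimate for the incremental dynamics *)

(** The term [D / (1 - lam)] is the fixed point of the affine map being iterated. The recursion is
    assumed before time [T] alone, as the inputs will be controlled on a finite window. *)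
Lemma geometric_bound (R : realType) (lam D : R) (V : nat -> R) (T : nat) :
  0 <= lam -> lam < 1 -> 0 <= D ->
  (forall t, (t < T)%N -> V t.+1 <= lam * V t + D) ->
  V T <= lam ^+ T * V 0%N + D / (1 - lam).
Proof.
move=> l0 l1 D0; elim: T => [|T IH] VD.
  by rewrite expr0 mul1r lerDl divr_ge0// subr_ge0 ltW.
apply: le_trans (VD T (ltnSn T)) _.
have {IH} := IH (fun t tT => VD t (ltnW tT)).
have -> : lam ^+ T.+1 * V 0%N + D / (1 - lam) =
    lam * (lam ^+ T * V 0%N + D / (1 - lam)) + D.
  by rewrite exprS; field; rewrite subr_eq0 gt_eqF.
by move=> h; rewrite lerD2r ler_wpM2l.
Qed.

Lemma bernoulli_le (R : realType) (x : R) (n : nat) :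
  0 <= x -> x <= 1 -> 1 - x *+ n <= (1 - x) ^+ n.
Proof.
move=> x0 x1; elim: n => [|n IH]; first by rewrite mulr0n subr0 expr0.
rewrite exprS; apply: le_trans (ler_wpM2l _ IH); last by rewrite subr_ge0.
rewrite mulrBl mul1r mulrBr mulr1 mulrS.
have : 0 <= x * (x *+ n) by rewrite mulr_ge0// mulrn_wge0.
by lra.
Qed.

(* With [W] the weighted maximum, [W top + K * W bottom] is a Lyapunov function:
   the weights [lam ^- i] turn the nilpotent shift into a contraction, at the
   price of a factor [lam ^- m.-1] on the new entry, paid for by
   [sqrt chi <= lam ^+ m]. *)
Lemma iss_estimate (R : realType) (m : nat) (chi : R) :
  (0 < m)%N -> 0 < chi -> chi < 1 ->
  exists lam C : R, [/\ 0 < lam, lam < 1, 0 < C &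
  forall (f : 'cV[R]_(m + m + 1) -> R) (r : R), 0 <= r ->
  (forall a b,
    `|f a - f b| <= Num.sqrt (chi / m%:R) * (enorm (a - b) + 2 * r)) ->
  forall xa va ea xb vb eb, solution f xa va ea -> solution f xb vb eb ->
  forall (s t : nat) (D : R), 0 <= D ->
  (forall i, (s <= i < s + t)%N -> `|va i - vb i| + `|ea i - eb i| <= D) ->
  enorm (xa (s + t)%N - xb (s + t)%N) <=
    C * (lam ^+ t * enorm (xa s - xb s) + D + r)].
Proof.
move=> m0 chi0 chi1; set th := Num.sqrt chi; set L := Num.sqrt (chi / m%:R).
have mR : 0 < m%:R :> R by rewrite ltr0n.
have th0 : 0 < th by rewrite sqrtr_gt0.
have th1 : th < 1.
  by rewrite -(ltr_pXn2r (n := 2)) ?nnegrE ?sqrtr_ge0// sqr_sqrtr ?expr1n ?ltW.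
have L0 : 0 <= L by exact: sqrtr_ge0.
have Lm : L * Num.sqrt m%:R = th.
  by rewrite -sqrtrM ?divr_ge0 ?(ltW chi0) ?ler0n// mulfVK// gt_eqF.
(* Chosen so that Bernoulli's inequality gives [th <= mu ^+ m]. Then the feedback through [f], of
   gain [th], still contracts by [mu] after multiplication by the last weight [Lam]. *)
pose mu := 1 - (1 - th) / m%:R.
have dth : (1 - th) / m%:R <= 1 - th.
  rewrite ler_pdivrMr// ler_peMr ?subr_ge0 ?(ltW th1)//.
  by rewrite ler1n.
have dth0 : 0 < (1 - th) / m%:R by rewrite divr_gt0// subr_gt0.
have mu0 : 0 < mu by rewrite /mu; lra.
have mu1 : mu < 1 by rewrite /mu; lra.
have thmu : th <= mu ^+ m.
  apply: le_trans (bernoulli_le m (ltW dth0) _); last by lra.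
  by rewrite -[_ *+ m]mulr_natr divfK ?gt_eqF//; lra.
pose Lam := mu ^- m.-1.
have Lam0 : 0 < Lam by rewrite invr_gt0 exprn_gt0.
have Lamth : Lam * th <= mu.
  by rewrite /Lam mulrC ler_pdivrMr ?exprn_gt0// -exprS prednK.
(* A rate strictly between [mu] and 1: the slack pays for the coupling of the bottom block into the
   top one. [K] below is the solution of [mu + K * mu = lam * K]. *)
pose lam := (1 + mu) / 2.
have lam0 : 0 < lam by rewrite /lam; lra.
have lam1 : lam < 1 by rewrite /lam; lra.
pose K := 2 * mu / (1 - mu).
have K0 : 0 < K by apply: divr_gt0; [exact: mulr_gt0|lra].
have KE : mu + K * mu = lam * K.
  by rewrite /K /lam; field; rewrite subr_eq0 gt_eqF.
(* [c1] and [c2] are the one-step gains of the inputs and of the defect; [c3] and [c4] compare [V]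
   with the Euclidean norm from either side. *)
pose c1 := Lam * (L + K + 1); pose c2 := 2 * Lam * L.
pose c3 := Num.sqrt m%:R * (1 + K^-1); pose c4 := (1 + K) * mu ^- m.
have c10 : 0 <= c1 by rewrite mulr_ge0 ?addr_ge0 ?(ltW K0) ?(ltW Lam0).
have c20 : 0 <= c2 by rewrite !mulr_ge0 ?(ltW Lam0).
have c30 : 0 <= c3.
  by rewrite mulr_ge0 ?sqrtr_ge0// addr_ge0// invr_ge0 ltW.
have c40 : 0 <= c4.
  by rewrite mulr_ge0 ?addr_ge0 ?(ltW K0)// invr_ge0 exprn_ge0// ltW.
have il0 : 0 < (1 - lam)^-1 by rewrite invr_gt0 subr_gt0.
pose A := c3 * c4; pose B1 := c3 * (c1 / (1 - lam));
pose B2 := c3 * (c2 / (1 - lam)).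
have A0 : 0 <= A by exact: mulr_ge0.
have B10 : 0 <= B1 by exact: mulr_ge0 c30 (mulr_ge0 c10 (ltW il0)).
have B20 : 0 <= B2 by exact: mulr_ge0 c30 (mulr_ge0 c20 (ltW il0)).
exists lam, (1 + A + B1 + B2); split=> //; first by lra.
move=> f r r0 fL xa va ea xb vb eb sola solb s t D D0 HD.
pose x i := xa i - xb i; pose W := @wmax R m mu.
pose V i := W (usubmx (x i)) + K * W (dsubmx (x i)).
have W0 z : 0 <= W z by exact: wmax_ge0.
have step i : V i.+1 <= lam * V i
    + (c1 * (`|va i - vb i| + `|ea i - eb i|) + c2 * r).
  set v := va i - vb i; set e := ea i - eb i.
  set fd := f (pair_cv (xa i) (va i)) - f (pair_cv (xb i) (vb i)).
  (* The incremental system is linear, with the increment [fd] of [f] acting as an extra input on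
     the top block. *)
  have xS : x i.+1 = sysA R m *m x i + (fd + e) *: sysG R m + v *: sysH R m.
    rewrite /x sola solb mulmxBr /fd /e /v.
    move: (_ *m xa i) (_ *m xb i) (sysG R m) (sysH R m) => P Q G' H'.
    by apply/colP => j; rewrite !mxE; ring.
  have xi : x i = col_mx (usubmx (x i)) (dsubmx (x i)) by rewrite vsubmxK.
  have [xu xd] :
      usubmx (x i.+1) = shift_mx R m *m usubmx (x i) + (fd + e) *: last_cv R m
      /\ dsubmx (x i.+1) = shift_mx R m *m dsubmx (x i) + v *: last_cv R m.
    rewrite xS {1 3}xi /sysA /sysG /sysH mul_block_col !scale_col_mx !mul0mx.
    rewrite !add_col_mx col_mxKu col_mxKd !scaler0 !addr0 add0r.
    by split.
  (* Passing from the Euclidean to the weighted norm costs [sqrt m], which turns [L] into [th]. *)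
  have fd_le : `|fd| <= th * W (usubmx (x i)) + th * W (dsubmx (x i))
      + L * `|v| + 2 * L * r.
    apply: le_trans (fL _ _) _.
    have -> : pair_cv (xa i) (va i) - pair_cv (xb i) (vb i) = pair_cv (x i) v.
      rewrite /pair_cv opp_col_mx add_col_mx; congr col_mx.
      by rewrite /v raddfB.
    have h1 := enorm_col_mx_le (x i) (v%:M : 'cV_1).
    have h2 := enorm_col_mx_le (usubmx (x i)) (dsubmx (x i)).
    rewrite vsubmxK in h2.
    have h3 := enorm_le_wmax mu0 mu1 (usubmx (x i)).
    have h4 := enorm_le_wmax mu0 mu1 (dsubmx (x i)).
    have h5 : enorm (v%:M : 'cV_1) <= `|v|.
      rewrite -[leRHS]mul1r -{1}sqrtr1; apply: enorm_le_sup => // j.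
      by rewrite !mxE !ord1 eqxx mulr1n.
    have := ler_wpM2l L0 (le_trans h1 (lerD (le_trans h2 (lerD h3 h4)) h5)).
    rewrite !mulrDr !mulrA Lm -/W => h.
    by lra.
  have hd : W (dsubmx (x i.+1)) <= mu * W (dsubmx (x i)) + Lam * `|v|.
    rewrite xd; apply: le_trans (wmax_shift mu0 _ _) _.
    rewrite -[_ / _]mulrC -/Lam ge_max lerDl lerDr.
    by rewrite (mulr_ge0 (ltW mu0))//= (mulr_ge0 (ltW Lam0)).
  (* Here [Lamth] replaces [Lam * th] by [mu] on both blocks; the bottom term is the coupling
     absorbed by [K]. *)
  have hu : W (usubmx (x i.+1)) <= mu * W (usubmx (x i)) + mu * W (dsubmx (x i))
      + Lam * (L * `|v| + `|e|) + c2 * r.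
    rewrite xu; apply: le_trans (wmax_shift mu0 _ _) _.
    have h1 := le_trans (ler_normD fd e) (lerD fd_le (lexx `|e|)).
    have := ler_wpM2l (ltW Lam0) h1; rewrite -[_ / _]mulrC -/Lam.
    have := ler_wpM2r (W0 (usubmx (x i))) Lamth.
    have := ler_wpM2r (W0 (dsubmx (x i))) Lamth.
    have : 0 <= Lam * (L * `|v| + `|e|)
      by rewrite mulr_ge0 ?addr_ge0 ?mulr_ge0 ?(ltW Lam0).
    have : 0 <= c2 * r by rewrite mulr_ge0.
    have : 0 <= mu * W (dsubmx (x i)) by rewrite mulr_ge0 ?(ltW mu0).
    rewrite ge_max -/(W (usubmx (x i))) /c2 => p1 p2 p3 p4 p5 p6.
    by apply/andP; split; lra.
  rewrite /V; have := ler_wpM2l (ltW K0) hd.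
  have mulam : mu * W (usubmx (x i)) <= lam * W (usubmx (x i)).
    by rewrite ler_wpM2r// /lam; lra.
  have e1 : mu * W (dsubmx (x i)) + K * (mu * W (dsubmx (x i))) =
      lam * (K * W (dsubmx (x i))).
    by rewrite mulrA -mulrDl KE mulrA.
  have e2 : Lam * (L * `|v| + `|e|) + K * (Lam * `|v|) <= c1 * (`|v| + `|e|).
    rewrite /c1 -subr_ge0.
    have -> : Lam * (L + K + 1) * (`|v| + `|e|)
        - (Lam * (L * `|v| + `|e|) + K * (Lam * `|v|))
      = Lam * (`|v| + (L + K) * `|e|) by ring.
    by rewrite mulr_ge0 ?addr_ge0 ?mulr_ge0 ?addr_ge0 ?(ltW K0) ?(ltW Lam0).
  by move: hu; lra.
have lower i : enorm (x i) <= c3 * V i.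
  have h2 := enorm_col_mx_le (usubmx (x i)) (dsubmx (x i)).
  rewrite vsubmxK in h2.
  have h3 := enorm_le_wmax mu0 mu1 (usubmx (x i)).
  have h4 := enorm_le_wmax mu0 mu1 (dsubmx (x i)).
  apply: le_trans (le_trans h2 (lerD h3 h4)) _.
  rewrite -mulrDr /c3 -mulrA ler_wpM2l ?sqrtr_ge0// /V -/W.
  set a := W _; set b := W _.
  have -> : (1 + K^-1) * (a + K * b) = a + b + (K * b + K^-1 * a).
    by field; rewrite gt_eqF.
  by rewrite lerDl addr_ge0// mulr_ge0 ?W0 ?invr_ge0 ?(ltW K0).
have upper i : V i <= c4 * enorm (x i).
  have hW z y : enorm z <= enorm y ->
      W z <= mu ^- m * enorm (y : 'cV[R]_(m + m)).
    move=> zy; apply: le_trans (wmax_le_enorm mu0 mu1 z) _.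
    by rewrite ler_wpM2l// invr_ge0 exprn_ge0// ltW.
  have hu := enorm_usubmx_le (x i); have hd := enorm_dsubmx_le (x i).
  rewrite /V /c4 -mulrA mulrDl mul1r lerD ?hW//.
  by rewrite ler_wpM2l ?hW ?(ltW K0).
(* The recursion is iterated from time [s], with the inputs bounded by [D] on the window. *)
have VT : V (s + t)%N <= lam ^+ t * V (s + 0)%N + (c1 * D + c2 * r) / (1 - lam).
  apply: (@geometric_bound _ _ _ (fun i => V (s + i)%N)) => [|//||i it].
  - exact: ltW.
  - by rewrite addr_ge0// mulr_ge0.
  - rewrite addnS; apply: le_trans (step _) _.
    rewrite lerD2l lerD2r ler_wpM2l// HD// leq_addr/=.
    by rewrite ltn_add2l.
rewrite addn0 in VT.
apply: le_trans (lower _) _.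
have lt0 : 0 <= lam ^+ t by rewrite exprn_ge0// ltW.
have := ler_wpM2l c30 (le_trans VT (lerD (ler_wpM2l lt0 (upper s)) (lexx _))).
move=> h; apply: le_trans h _; rewrite -/(x s).
set E := enorm (x s).
have E0 : 0 <= lam ^+ t * E by rewrite mulr_ge0 ?enorm_ge0.
have -> : c3 * (lam ^+ t * (c4 * E) + (c1 * D + c2 * r) / (1 - lam)) =
  A * (lam ^+ t * E) + B1 * D + B2 * r by rewrite /A /B1 /B2; ring.
move: (lam ^+ t * E) E0 => F F0.
have := mulr_ge0 A0 D0; have := mulr_ge0 A0 r0.
have := mulr_ge0 B10 F0; have := mulr_ge0 B10 r0.
have := mulr_ge0 B20 F0; have := mulr_ge0 B20 D0.
by lra.
Qed.

(** * Comparison functions *)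

Lemma class_K_linear (R : realType) (C : R) : 0 < C -> class_K (fun s => C * s).
Proof.
move=> C0; split; last by rewrite mulr0.
- apply: continuous_subspaceT => s.
  by apply: cvgM; [exact: cvg_cst|exact: cvg_id].
- by move=> r s _ _ rs; rewrite ltr_pM2l.
Qed.

Lemma class_K_sqrt (R : realType) (C : R) :
  0 < C -> class_K (fun s => C * Num.sqrt s).
Proof.
move=> C0; split; last by rewrite sqrtr0 mulr0.
- apply: continuous_subspaceT => s.
  by apply: cvgM; [exact: cvg_cst|exact: sqrt_continuous].
- move=> r s; rewrite !in_itv/= !andbT => r0 s0 rs.
  by rewrite ltr_pM2l// ltr_sqrt// (le_lt_trans r0).
Qed.

Lemma class_KL_exp (R : realType) (C c : R) : 0 < C -> 0 < c ->
  class_KL (fun s t => C * expR (- (c * t)) * s).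
Proof.
move=> C0 c0; split=> [t _|s s0].
  by apply: class_K_linear; rewrite mulr_gt0// expR_gt0.
split.
- apply: continuous_subspaceT => t.
  apply: cvgM; last exact: cvg_cst.
  apply: cvgM; first exact: cvg_cst.
  apply: continuous_comp; last exact: continuous_expR.
  by apply: cvgN; apply: cvgM; [exact: cvg_cst|exact: cvg_id].
- move=> r t _ _ rt; rewrite ler_wpM2r// ler_wpM2l ?(ltW C0)// ler_expR.
  by rewrite lerN2 ler_wpM2l// ltW.
- rewrite -[X in _ --> X](mul0r s); apply: cvgM; last exact: cvg_cst.
  rewrite -[X in _ --> X](mulr0 C); apply: cvgM; first exact: cvg_cst.
  apply: (cvg_comp (fun t => c * t) (fun x => expR (- x)));
    last exact: cvgr_expR.
  exact: gt0_cvgMry.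
Qed.

(** From [1 + x <= expR x] at [x = lam - 1]. It passes from powers at integer times to a decay
    defined at all real times, as class KL demands. *)
Lemma exp_expR_le (R : realType) (lam : R) (t : nat) : 0 <= lam ->
  lam ^+ t <= expR (- ((1 - lam) * t%:R)).
Proof.
move=> l0; rewrite -mulNr mulrC expRM_natl lerXn2r ?nnegrE ?expR_ge0//.
by have := expR_ge1Dx (- (1 - lam)); lra.
Qed.

(** * Upper limits and supremum norms of sequences *)

Lemma limn_esup_le (R : realType) (u : nat -> \bar R) (T : nat) (l : \bar R) :
  (forall t, (T <= t)%N -> (u t <= l)%E) -> (limn_esup u <= l)%E.
Proof.
move=> ul; apply: (@le_trans _ _ (ereal_sup (u @` [set t | (T <= t)%N]))).
  apply: ereal_inf_lbound; exists [set t | (T <= t)%N] => //.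
  by exists T.
by apply: ge_ereal_sup => _ [t Tt <-]; exact: ul.
Qed.

Lemma limn_esup_lt (R : realType) (u : nat -> \bar R) (l : \bar R) :
  (limn_esup u < l)%E -> exists T, forall t, (T <= t)%N -> (u t < l)%E.
Proof.
move=> /ereal_inf_lt[_ [V [T _ TV] <-] Vl]; exists T => t Tt.
apply: le_lt_trans Vl; apply: ereal_sup_ubound; exists t => //.
exact: TV.
Qed.

Lemma limn_esup_ge0 (R : realType) (u : nat -> \bar R) :
  (forall t, (0 <= u t)%E) -> (0 <= limn_esup u)%E.
Proof.
move=> u0; rewrite leNgt; apply/negP => /limn_esup_lt[T /(_ T (leqnn T))].
by rewrite ltNge u0.
Qed.

Lemma supnorm_le (R : realType) (u : nat -> R) (q : R) :
  (supnorm u <= q%:E)%E <-> forall t, u t <= q.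
Proof.
split=> [uq t|uq].
  by rewrite -lee_fin; apply: le_trans uq; apply: ereal_sup_ubound; exists t.
by apply: ge_ereal_sup => _ [t _ <-]; rewrite lee_fin.
Qed.

(** * The three stability properties from the exponential estimate *)

Section IssConsequences.
Variables (R : realType) (m : nat) (lam C r : R).
Variable f : 'cV[R]_(m + m + 1) -> R.
Hypotheses (lam0 : 0 < lam) (lam1 : lam < 1) (C0 : 0 < C) (r0 : 0 <= r).
Hypothesis iss : forall xa va ea xb vb eb,
  solution f xa va ea -> solution f xb vb eb ->
  forall (s t : nat) (D : R), 0 <= D ->
  (forall i, (s <= i < s + t)%N -> `|va i - vb i| + `|ea i - eb i| <= D) ->
  enorm (xa (s + t)%N - xb (s + t)%N) <=
    C * (lam ^+ t * enorm (xa s - xb s) + D + r).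

Lemma iss_dBIBS : dBIBS f.
Proof.
(* One [q] bounds the initial state and [2 * q] bounds the sum of the two inputs. *)
move=> q q0; exists (C * (q + 2 * q + r)).
  by rewrite mulr_ge0 ?(ltW C0)// !addr_ge0// mulr_ge0.
move=> xa va ea xb vb eb sa sb x0 /supnorm_le vq /supnorm_le eq.
apply/supnorm_le => t.
have := iss sa sb (s := 0%N) (t := t) (mulr_ge0 (ler0n R 2) q0).
rewrite add0n => h; apply: le_trans (h _) _ => [i _|].
  by have := vq i; have := eq i; rewrite /=; lra.
rewrite ler_wpM2l ?(ltW C0)// !lerD2r.
apply: le_trans x0; rewrite ler_piMl ?enorm_ge0//.
by rewrite exprn_ile1// ltW.
Qed.

(** The estimate is restarted at a time [s] after which the inputs stay close to their upper limit;
    the contribution of the state at time [s] then dies out. The factor 2 in the gain comes from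
    bounding a sum of two inputs by twice their maximum. *)
Lemma iss_wdAG (b : R) : C * r <= b -> wdAG f b.
Proof.
move=> rb; split; first by apply: le_trans rb; rewrite mulr_ge0// ltW.
exists (fun s => 2 * C * s); first by apply: class_K_linear; rewrite mulr_gt0.
move=> xa va ea xb vb eb sa sb L Loo.
have L0 : (0 <= L)%E.
  by apply: limn_esup_ge0 => t; rewrite lee_fin le_max normr_ge0.
have Lfin : L \is a fin_num by rewrite ge0_fin_numE.
have l0 : 0 <= fine L by rewrite fine_ge0.
apply/lee_addgt0Pr => e e0.
(* The error [e] is spent as three copies of [C * d]: one for the decayed state and two for the
   inputs. *)
pose d := e / (3 * C).
have d0 : 0 < d by rewrite divr_gt0// mulr_gt0.
have [s sL] : exists s, forall t, (s <= t)%N ->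
    ((Num.max `|va t - vb t| `|ea t - eb t|)%:E < (fine L + d)%:E)%E.
  by apply: limn_esup_lt; rewrite -/L -{1}(fineK Lfin) lte_fin ltrDl.
pose E := enorm (xa s - xb s).
have [T HT] : exists T, forall t, (T <= t)%N -> lam ^+ t * E <= d.
  (* Dividing by [E + 1] rather than [E] covers the case [E = 0]. *)
  have E1 : 0 < E + 1 by rewrite ltr_wpDl ?enorm_ge0.
  have /cvgrPdist_lt /(_ (d / (E + 1)) (divr_gt0 d0 E1)) [T _ HT] :
      lam ^+ t @[t --> \oo] --> (0 : R).
    by apply: cvg_expr; rewrite ger0_norm// ltW.
  exists T => t /HT /=; rewrite sub0r normrN ger0_norm ?exprn_ge0 ?(ltW lam0)//.
  rewrite (ltr_pdivlMr _ _ E1) => h.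
  apply: le_trans (ltW h); rewrite ler_wpM2l ?exprn_ge0 ?(ltW lam0)//.
  by rewrite lerDl.
apply: (@limn_esup_le _ _ (s + T)%N) => t sTt.
have -> : t = (s + (t - s))%N
  by rewrite subnKC// (leq_trans (leq_addr _ _) sTt).
rewrite lee_fin.
have D0 : 0 <= 2 * (fine L + d) by rewrite mulr_ge0// addr_ge0// ltW.
apply: le_trans (iss sa sb D0 _) _ => [i /andP[si _]|].
  have := sL i si; rewrite lte_fin gt_max => /andP[]; lra.
have /HT h : (T <= t - s)%N
  by rewrite leq_subRL ?(leq_trans (leq_addr _ _) sTt).
have dE : 3 * C * d = e by rewrite /d; field; rewrite gt_eqF.
have := ler_wpM2l (ltW C0) h; rewrite !mulrDr -/E; lra.
Qed.

Lemma iss_dISS : r = 0 -> dISS f.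
Proof.
move=> rE; exists (fun s t => C * expR (- ((1 - lam) * t)) * s),
  (fun s => C * s), (fun s => C * s).
split; [|exact: class_K_linear|exact: class_K_linear|].
  by apply: class_KL_exp; rewrite ?subr_gt0.
move=> xa va ea xb vb eb sa sb t.
set v := supnorm_upto _ t; set e := supnorm_upto (fun i => `|ea i - eb i|) t.
have v0 : 0 <= v by exact: bigmax_ge_id.
have e0 : 0 <= e by exact: bigmax_ge_id.
(* With [D] the sum of the two supremum norms, the single input term splits into the two gains. *)
have := iss sa sb (s := 0%N) (t := t) (addr_ge0 v0 e0).
rewrite add0n => h; apply: le_trans (h _) _ => [i /andP[_ it]|].
  (* The estimate sees inputs before time [t], while the supremum norms run up to [t] inclusive. *)
  have it1 : (i < t.+1)%N by rewrite ltnW.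
  by apply: lerD;
    [exact: (le_bigmax 0 (fun i : 'I_t.+1 => `|va i - vb i|) (Ordinal it1))
    |exact: (le_bigmax 0 (fun i : 'I_t.+1 => `|ea i - eb i|) (Ordinal it1))].
rewrite rE addr0 addrA mulrDr lerD2r mulrDr lerD2r mulrA ler_wpM2r ?enorm_ge0//.
by rewrite ler_wpM2l ?(ltW C0)// exp_expR_le// ltW.
Qed.

End IssConsequences.

(** * Stability of the identified system *)

Theorem theorem4 (R : realType) (m n neta : nat) (hm : (0 < m)%N)
    (hn : (m < n)%N) (u y : nat -> R)
    (k : kernel_structure R (m + m + 1) neta)
    (J : R -> 'cV[R]_neta -> R) (iota chi : R)
    (hiota : 0 < iota) (hchi0 : 0 < chi) (hchi1 : chi < 1) :
  exists2 b : R -> R, class_K b &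
    forall (rho : \bar R) (beta : R) (eta : 'cV[R]_neta)
      (H : rkhs (k eta)) (f : 'cV[R]_(m + m + 1) -> R),
    (0 <= rho)%E ->
    delta_viable k rho ->
    minimizer [set p : R * 'cV[R]_neta |
                 iota <= p.1 /\ viability_set k rho p.2]
              (fun p => J p.1 p.2) (beta, eta) ->
    minimizer [set g | rk_mem H g /\ m%:R * rk_norm H g ^+ 2 <= chi]
              (fit_cost n u y beta H) f ->
    [/\ dBIBS f,
        unif_continuous f ->
          (forall r : R, rho = r%:E -> wdAG f (b r)) /\
          (rho = +oo%E -> exists c : R, wdAG f c) &
        rho = 0%E -> dISS f].
Proof.
have [lam [C [lam0 lam1 C0 est]]] := iss_estimate hm hchi0 hchi1.
(* [C] depends on [m] and [chi] alone, so the bias function is fixed before [rho], the kernel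
   parameter and [f]. *)
exists (fun r => C * Num.sqrt r); first exact: class_K_sqrt.
move=> rho beta eta H f rho0 _
  [[_ [_ [nu [s [nu0 nurho _ viab]]]]] _] [[Hf fchi] _].
have mR : 0 < m%:R :> R by rewrite ltr0n.
have normf : rk_norm H f <= Num.sqrt (chi / m%:R).
  rewrite -[leLHS](ger0_norm (sqrtr_ge0 _)) -sqrtr_sqr ler_wsqrtr//.
  by rewrite ler_pdivlMr// mulrC.
(* Viability of [eta] and the norm constraint on [f] give the increment bound with defect
   [sqrt nu]. *)
have iss := est f (Num.sqrt nu) (sqrtr_ge0 _) _.
have {}iss := iss (fun a b => le_trans
  (viable_rkhs_diff_le nu0 (fun a b => (viab a b).1) Hf a b)
  (ler_wpM2r (addr_ge0 (enorm_ge0 _) (mulr_ge0 (ler0n _ 2) (sqrtr_ge0 _)))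
     normf)).
split.
- exact: iss_dBIBS lam0 lam1 C0 (sqrtr_ge0 _) iss.
- move=> _; split=> [r rhoE|_].
    apply: (iss_wdAG lam0 lam1 C0 (sqrtr_ge0 _) iss).
    rewrite ler_wpM2l ?(ltW C0)// ler_wsqrtr//.
    by rewrite -lee_fin -rhoE.
  (* For infinite [rho], the real number [nu] attached to [eta] still yields a finite bias. *)
  by exists (C * Num.sqrt nu); exact: (iss_wdAG lam0 lam1 C0 (sqrtr_ge0 _) iss).
(* When [rho] is zero, so is [nu], and the defect vanishes. *)
- move=> rhoE; apply: (iss_dISS lam0 lam1 C0 iss).
  have : nu <= 0 by move: nurho; rewrite rhoE lee_fin.
  by move/ler0_sqrtr.
Qed.
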